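(* Let $n\ge1$, let $\theta$ be a complex skew-symmetric $n\times n$ matrix, and let $1\le d'\le d\le n$. The noncommutative minors of order $d$ and $d'$ in $\mathrm{GL}_\theta(n)$ obey the Young symmetry relations $$\sum_{\gamma=1}^{d+1}(-1)^{\gamma+1}\Big(\prod_{\mu=1}^{d}q_{i_\gamma i^\gamma_\mu}\Big)\Big(\prod_{\nu=1}^{d'-1}q_{i_\gamma j_\nu}\Big)\,\Lambda^{I^\gamma}\,\Lambda^{i_\gamma\cup J}=0$$ for every choice of multi-indices $I=(i_1\cdots i_{d+1})$ and $J=(j_1\cdots j_{d'-1})$ with entries in $\{1,\dots,n\}$, $|I|=d+1$ and $|J|=d'-1$.
   Context: Put $q_{ij}=\exp(\tfrac{\mathrm i}{2}\theta^{ij})$ and $Q_{ij;kl}=q_{ki}\,q_{jl}$. $\mathcal F_n^\theta$, the algebra of $\mathrm{GL}_\theta(n)$, is generated by $g_{ij}$, $1\le i,j\le n$, with relations $g_{ij}\,g_{kl}=Q^2_{ij;kl}\;g_{kl}\,g_{ij}$. For multi-indices $K=(k_1\cdots k_m)$ (rows) and $J=(j_1\cdots j_m)$ (columns), not necessarily ordered, the noncommutative minor of order $m$ is $$\Lambda^{KJ}=\sum_{\sigma\in S_m}\mathrm{sgn}(\sigma)\Big(\prod_{1\le a<b\le m}Q_{k_b\,j_{\sigma(b)}\,;\,k_a\,j_{\sigma(a)}}\Big)\,g_{k_1j_{\sigma(1)}}\cdots g_{k_mj_{\sigma(m)}},$$ with products in $\mathcal F_n^\theta$. A minor of order $m$ written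 with a single (column) multi-index has row multi-index $(1\,2\cdots m)$: $\Lambda^J=\Lambda^{(1\cdots m)J}$ with $m=|J|$. Thus $\Lambda^{I^\gamma}$ is a minor of order $d$ (rows $1,\dots,d$) and $\Lambda^{i_\gamma\cup J}$ is a minor of order $d'$ (rows $1,\dots,d'$). $I^\gamma=I\setminus\{i_\gamma\}=(i^\gamma_1\cdots i^\gamma_d)$ is $I$ with its $\gamma$-th entry removed, the remaining entries keeping their order, and $i_\gamma\cup J=(i_\gamma\,j_1\cdots j_{d'-1})$ is the concatenation. *)

(* Defs.v *)
From HB Require Import structures.
From mathcomp Require Import all_boot all_order all_algebra perm.
From mathcomp Require Import boolp reals sequences exp trigo.
From mathcomp Require Import complex ring.
From mathcomp.multinomials Require Import monalg.

Set Implicit Arguments.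
Unset Strict Implicit.
Unset Printing Implicit Defensive.

Import GRing.Theory.

Local Open Scope ring_scope.
Local Open Scope quotient_scope.

(* The libraries only have the real exponential; this is its usual extension  *)
(* exp(x + i y) = e^x (cos y + i sin y) to complex arguments.                 *)
Definition cexp (R : realType) (z : R[i]) : R[i] :=
  ((expR (complex.Re z) * cos (complex.Im z))
     +i* (expR (complex.Re z) * sin (complex.Im z)))%C.

Lemma cexp0 (R : realType) : cexp 0 = 1 :> R[i].
Proof. by rewrite /cexp /= expR0 cos0 sin0 !mul1r. Qed.

Lemma cexpD (R : realType) (z w : R[i]) : cexp (z + w) = cexp z * cexp w.
Proof.
case: z w => [a b] [c d]; apply/eqP; rewrite eq_complex /=.
by rewrite expRD cosD sinD; apply/andP; split; apply/eqP; ring.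
Qed.

Inductive two_sided_ideal (A : pzRingType) (S : A -> Prop) : A -> Prop :=
| Ideal_gen x of S x : two_sided_ideal S x
| Ideal_0 : two_sided_ideal S 0
| Ideal_D x y of two_sided_ideal S x & two_sided_ideal S y :
    two_sided_ideal S (x + y)
| Ideal_Ml a x of two_sided_ideal S x : two_sided_ideal S (a * x)
| Ideal_Mr a x of two_sided_ideal S x : two_sided_ideal S (x * a).

Section GLtheta.
Variables (R : realType) (n : nat) (theta : 'M[R[i]]_n).

Definition qtheta (i j : 'I_n) : R[i] := cexp ('i%C / 2%:R * theta i j).

Definition Qtheta (i j k l : 'I_n) : R[i] := qtheta k i * qtheta j l.

(* The free unital associative algebra on the n^2 letters (i, j): monoid      *)
(* algebra of the free monoid of words in these letters.                      *)
Definition freeGL := {malg R[i][{fmonom ('I_n * 'I_n)%type}]}.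

Definition freeg (i j : 'I_n) : freeGL := << fmu (i, j) >>.

Definition GLrel (x : freeGL) : Prop :=
  exists i j k l : 'I_n,
    x = freeg i j * freeg k l - Qtheta i j k l ^+ 2 *: (freeg k l * freeg i j).

Definition GLideal : {pred freeGL} :=
  fun x => `[< two_sided_ideal GLrel x >].

Lemma GLidealP x : reflect (two_sided_ideal GLrel x) (x \in GLideal).
Proof. exact: asboolP. Qed.

Lemma GLideal_zmod_closed : zmod_closed GLideal.
Proof.
split=> [|x y /GLidealP Ix /GLidealP Iy]; apply/GLidealP; first exact: Ideal_0.
by apply: Ideal_D => //; rewrite -mulN1r; apply: Ideal_Ml.
Qed.

HB.instance Definition _ :=
  GRing.isZmodClosed.Build freeGL GLideal GLideal_zmod_closed.

Lemma GLidealMl a x : x \in GLideal -> a * x \in GLideal.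
Proof. by move=> /GLidealP Ix; apply/GLidealP/Ideal_Ml. Qed.

Lemma GLidealMr a x : x \in GLideal -> x * a \in GLideal.
Proof. by move=> /GLidealP Ix; apply/GLidealP/Ideal_Mr. Qed.

Lemma GLidealZ c x : x \in GLideal -> c *: x \in GLideal.
Proof. by move=> Ix; rewrite -mul_malgC; apply: GLidealMl. Qed.

(* Elements of the ideal have no constant term, so the ideal is proper.       *)
Lemma GLideal_mcoeff0 x : x \in GLideal -> mcoeff mone x = 0.
Proof.
move=> /GLidealP; elim=> {x} [x|||a x _ IH|a x _ IH].
- move=> [i [j [k [l ->]]]]; rewrite raddfB /= mcoeffZ !rmorphM /=.
  have g0 (a b : 'I_n) : mcoeff mone (freeg a b) = 0.
    rewrite mcoeffU1; case: eqP => // /(congr1 (@fmonom_val _)).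
    by rewrite fmU fm1.
  by rewrite !g0 !mul0r mulr0 subrr.
- exact: raddf0.
- by move=> x y _ IHx _ IHy; rewrite raddfD /= IHx IHy addr0.
- by rewrite rmorphM /= IH mulr0.
- by rewrite rmorphM /= IH mul0r.
Qed.

Lemma GLideal1 : 1 \notin GLideal.
Proof.
by apply/negP => /GLideal_mcoeff0 /eqP; rewrite rmorph1 oner_eq0.
Qed.

(* [ring_quotient] makes a Z-module of the quotient by any additive subgroup, *)
(* but has a ring structure only in the commutative case; the ring and        *)
(* algebra structures of the quotient are therefore built below.              *)
Definition FGL := Quotient.quot GLideal.
HB.instance Definition _ := GRing.Zmodule.on FGL.

Definition piGL (x : freeGL) : FGL := \pi_FGL x.

Lemma piGL_eqP x y : reflect (piGL x = piGL y) (x - y \in GLideal).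
Proof. by rewrite Quotient.idealrBE; apply: eqP. Qed.

Lemma piGLB x y : piGL (x - y) = piGL x - piGL y.
Proof. by rewrite /piGL !piE. Qed.

Lemma piGLD x y : piGL (x + y) = piGL x + piGL y.
Proof. by rewrite /piGL !piE. Qed.

Lemma reprGLK u : piGL (repr u) = u.
Proof. exact: reprK. Qed.

Definition oneGL : FGL := piGL 1.
Definition mulGL (u v : FGL) : FGL := piGL (repr u * repr v).
Definition scaleGL (c : R[i]) (u : FGL) : FGL := piGL (c *: repr u).

Lemma piGLM x y : piGL (x * y) = mulGL (piGL x) (piGL y).
Proof.
apply/piGL_eqP; set x' := repr _; set y' := repr _.
have -> : x * y - x' * y' = x * (y - y') + (x - x') * y'.
  by rewrite mulrBr mulrBl addrA subrK.
by apply: rpredD; [apply: GLidealMl|apply: GLidealMr];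
  apply/piGL_eqP; rewrite reprGLK.
Qed.

Lemma piGLZ c x : piGL (c *: x) = scaleGL c (piGL x).
Proof.
apply/piGL_eqP; rewrite -scalerBr; apply: GLidealZ.
by apply/piGL_eqP; rewrite reprGLK.
Qed.

Lemma FGLind (P : FGL -> Prop) : (forall x, P (piGL x)) -> forall u, P u.
Proof. by move=> HP u; rewrite -[u]reprGLK. Qed.

Lemma mulGLA : associative mulGL.
Proof.
by elim/FGLind=> x; elim/FGLind=> y; elim/FGLind=> z; rewrite -!piGLM mulrA.
Qed.

Lemma mul1GL : left_id oneGL mulGL.
Proof. by elim/FGLind=> x; rewrite -piGLM mul1r. Qed.

Lemma mulGL1 : right_id oneGL mulGL.
Proof. by elim/FGLind=> x; rewrite -piGLM mulr1. Qed.

Lemma mulGLDl : left_distributive mulGL +%R.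
Proof.
by elim/FGLind=> x; elim/FGLind=> y; elim/FGLind=> z;
  rewrite -piGLD -!piGLM -piGLD mulrDl.
Qed.

Lemma mulGLDr : right_distributive mulGL +%R.
Proof.
by elim/FGLind=> x; elim/FGLind=> y; elim/FGLind=> z;
  rewrite -piGLD -!piGLM -piGLD mulrDr.
Qed.

Lemma oneGL_neq0 : oneGL != 0.
Proof.
apply/negP => /eqP; have -> : 0 = piGL 0 by rewrite /piGL !piE.
by move=> /piGL_eqP; rewrite subr0; apply/negP/GLideal1.
Qed.

HB.instance Definition _ := GRing.Zmodule_isNzRing.Build FGL
  mulGLA mul1GL mulGL1 mulGLDl mulGLDr oneGL_neq0.

Lemma scaleGLA a b u : scaleGL a (scaleGL b u) = scaleGL (a * b) u.
Proof. by elim/FGLind: u => x; rewrite -!piGLZ scalerA. Qed.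

Lemma scaleGL1 : left_id 1 scaleGL.
Proof. by elim/FGLind=> x; rewrite -piGLZ scale1r. Qed.

Lemma scaleGLDr : right_distributive scaleGL +%R.
Proof.
by move=> c; elim/FGLind=> x; elim/FGLind=> y;
  rewrite -piGLD -!piGLZ -piGLD scalerDr.
Qed.

Lemma scaleGLDl u : {morph scaleGL^~ u : a b / a + b}.
Proof. by elim/FGLind: u => x a b; rewrite -!piGLZ -piGLD scalerDl. Qed.

HB.instance Definition _ := GRing.Zmodule_isLmodule.Build R[i] FGL
  scaleGLA scaleGL1 scaleGLDr scaleGLDl.

Lemma scaleGLAl (c : R[i]) (u v : FGL) : c *: (u * v) = c *: u * v.
Proof.
elim/FGLind: u => x; elim/FGLind: v => y.
by rewrite /GRing.scale /GRing.mul /= -piGLZ -!piGLM -piGLZ scalerAl.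
Qed.

HB.instance Definition _ := GRing.Lmodule_isLalgebra.Build R[i] FGL scaleGLAl.

Lemma malg_scaleAr (c : R[i]) (x y : freeGL) : c *: (x * y) = x * (c *: y).
Proof.
have cx : malgC c * x = x * malgC c.
  rewrite !malgM_def fgmulUg fgmulgU; apply: eq_bigr => k _.
  by rewrite mul1m mulm1 mulrC.
by rewrite -(mul_malgC c (x * y)) -(mul_malgC c y) !mulrA cx.
Qed.

Lemma scaleGLAr (c : R[i]) (u v : FGL) : c *: (u * v) = u * (c *: v).
Proof.
elim/FGLind: u => x; elim/FGLind: v => y.
by rewrite /GRing.scale /GRing.mul /= -piGLZ -!piGLM -piGLZ malg_scaleAr.
Qed.

HB.instance Definition _ := GRing.Lalgebra_isAlgebra.Build R[i] FGL scaleGLAr.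

Definition gtheta (i j : 'I_n) : FGL := piGL (freeg i j).

Lemma gtheta_rel (i j k l : 'I_n) :
  gtheta i j * gtheta k l = Qtheta i j k l ^+ 2 *: (gtheta k l * gtheta i j).
Proof.
rewrite /GRing.scale /GRing.mul /= -!piGLM -piGLZ; apply/piGL_eqP/GLidealP.
by apply: Ideal_gen; exists i, j, k, l.
Qed.

Definition minor (m : nat) (K J : m.-tuple 'I_n) : FGL :=
  \sum_(s : 'S_m)
    ((-1) ^+ s
       * \prod_(a < m) \prod_(b < m | (a < b)%N)
           Qtheta (tnth K b) (tnth J (s b)) (tnth K a) (tnth J (s a)))
    *: \prod_(a < m) gtheta (tnth K a) (tnth J (s a)).

Definition first_rows (m : nat) (le_mn : (m <= n)%N) : m.-tuple 'I_n :=
  [tuple widen_ord le_mn a | a < m].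

Definition minor_cols (m : nat) (le_mn : (m <= n)%N) (J : m.-tuple 'I_n) :
  FGL := minor (first_rows le_mn) J.

Definition del_entry (d : nat) (I : d.+1.-tuple 'I_n) (c : 'I_d.+1) :
  d.-tuple 'I_n := [tuple tnth I (lift c mu) | mu < d].

(* The concatenation has length d'.-1.+1, cast to d' using d' > 0.            *)
Definition cons_entry (d' : nat) (d'_gt0 : (0 < d')%N) (i : 'I_n)
  (J : d'.-1.-tuple 'I_n) : d'.-tuple 'I_n :=
  tcast (prednK d'_gt0) [tuple of i :: J].

End GLtheta.

(* Main.v *)
Require Import Defs.
From HB Require Import structures.
From mathcomp Require Import all_boot all_order all_algebra perm.
From mathcomp Require Import reals complex ring.

Set Implicit Arguments.
Unset Strict Implicit.
Unset Printing Implicit Defensive.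

Import GRing.Theory.
Local Open Scope ring_scope.

(** The algebra of GL_theta(n) is a cocycle deformation of a commutative
    polynomial ring. Its generators satisfy g x * g y = Q x y ^+ 2 *: g y * g x
    with Q x y * Q y x = 1, so that the rescaled word
<<
      N (x_1 ... x_m) = (prod_(a < b) Q x_b x_a) *: (g x_1 * ... * g x_m)
>>
    depends only on the multiset of its letters ([normal_word_perm]): N sends
    commutative monomials to the algebra. The scalars in the definition of a
    noncommutative minor are those of N, so a minor is the image under N of the
    classical determinant. The product of two normal-ordered words is again a
    normal-ordered word, up to the product of the Q x y over the letters x of
    the first and y of the second ([normal_wordM]).

    Here Q x y is a factor in the two rows times a factor in the two columns.
    Hence, in a product of two minors, the scalar coming from [normal_wordM] is
    the same for every pair of permutations ([prod_Qfactor]). For the product of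
    the minors with columns I^c and i_c J, it contains the factors
    q (i^c_mu) (i_c), which the prefactors q (i_c) (i^c_mu) of the Young
    relation cancel, and the q (i^c_mu) (j_nu), which the prefactors
    q (i_c) (j_nu) complete to the product of q i j over all entries i of I and
    j of J. The total scalar is thus independent of c, and the classical Young
    symmetry relation remains, in which N is only known to be symmetric in its
    letters.

    For the classical relation ([young_exchange]), fix the permutation t of the
    second minor: the column i_c is paired there with some row r, and since the
    second minor is not larger than the first, r is also a row of the first
    minor. The choice of c and the permutation of the first minor amount to one
    permutation p of the d + 1 entries of I, which sends the last position to
    c. Exchanging the values of p at r and at the last position exchanges the
    letters (r, i_(p r)) and (r, i_c) of the two words. This leaves the multiset
    of letters unchanged but changes the sign of p, so the terms cancel in
    pairs. *)

(** * Normal-ordered words in a twisted-commutative algebra *)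

Section NormalOrdering.
Variables (k : comNzRingType) (A : algType k) (L : eqType).
Variables (Q : L -> L -> k) (g : L -> A).
Hypothesis QV : forall x y, Q x y * Q y x = 1.
Hypothesis gC : forall x y, g x * g y = Q x y ^+ 2 *: (g y * g x).

(** This is the N of the introduction: the scalar attached to a letter x
    collects the Q y x over the letters y to its right. *)
Fixpoint normal_word (s : seq L) : A :=
  if s is x :: s' then (\prod_(y <- s') Q y x) *: (g x * normal_word s') else 1.

(** Moving g x across g y costs Q x y ^+ 2, which is exactly the ratio of the
    scalars Q x y and Q y x = (Q x y)^-1 of the two words. *)
Lemma normal_word_swap x y s :
  normal_word (x :: y :: s) = normal_word (y :: x :: s).
Proof.
rewrite /= !big_cons -!scalerAr !scalerA !mulrA gC -!scalerAl !scalerA.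
congr (_ *: _); rewrite expr2.
transitivity (Q y x * Q x y * (Q x y * (\prod_(z <- s) Q z x) *
  \prod_(z <- s) Q z y)); first by ring.
by rewrite QV; ring.
Qed.

Lemma normal_word_move s x t :
  normal_word (s ++ x :: t) = normal_word (x :: s ++ t).
Proof.
elim: s => // y s IHs; rewrite !cat_cons normal_word_swap.
rewrite [LHS]/= IHs; congr (_ *: _).
by apply: perm_big; rewrite perm_sym -cat1s perm_catCA.
Qed.

(** Normal ordering makes the letters commute: N factors through multisets. *)
Lemma normal_word_perm s t :
  perm_eq s t -> normal_word s = normal_word t.
Proof.
elim: s t => [|x s IHs] t.
  by rewrite perm_sym => /perm_nilP->.
move=> eq_st; have: x \in t by rewrite -(perm_mem eq_st) mem_head.
move=> x_t; case/splitPr: x_t eq_st => t1 t2 eq_st.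
rewrite normal_word_move /=.
have eq_st' : perm_eq s (t1 ++ t2).
  by rewrite -(perm_cons x) (perm_trans eq_st) // -cat1s perm_catCA.
by rewrite (IHs _ eq_st') (perm_big _ eq_st').
Qed.

(** The concatenation carries the extra scalars Q y x for x in s and y in t;
    the Q x y compensate them. *)
Lemma normal_wordM s t :
  normal_word s * normal_word t =
    (\prod_(x <- s) \prod_(y <- t) Q x y) *: normal_word (s ++ t).
Proof.
elim: s => [|x s IHs]; first by rewrite big_nil scale1r mul1r.
rewrite /= big_cons -scalerAl -mulrA IHs -scalerAr !scalerA.
congr (_ *: _); rewrite big_cat /=.
have QtV : (\prod_(y <- t) Q x y) * (\prod_(y <- t) Q y x) = 1.
  by rewrite -big_split /=; apply: big1 => y _.
have cancel (a b c e : k) : c * e = 1 -> a * b = c * b * (a * e).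
  by move=> ce; rewrite -[LHS]mulr1 -ce; ring.
exact: cancel.
Qed.

(** The scalar on the right is the one in the definition of a minor. *)
Lemma normal_word_ord m (x : 'I_m -> L) :
  normal_word [seq x a | a <- enum 'I_m] =
    (\prod_(a < m) \prod_(b < m | (a < b)%N) Q (x b) (x a))
      *: \prod_(a < m) g (x a).
Proof.
elim: m x => [|m IHm] x; first by rewrite enum_ord0 !big_ord0 scale1r.
rewrite enum_ordSl /= -map_comp IHm -scalerAr scalerA !big_ord_recl /=.
congr (_ * _ *: _).
  by rewrite big_map big_enum [RHS]big_mkcond big_ord_recl /= mul1r.
apply: eq_bigr => a _.
by rewrite [RHS]big_mkcond big_ord_recl /= mul1r -big_mkcond.
Qed.

End NormalOrdering.

(** * Alternating sums over permutations *)

Section AlternatingSums.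
Variables (k : pzRingType) (V : lmodType k).

(** A permutation of d + 1 points is the choice of the image j of a given point
    i together with a bijection between the d remaining points on each side. *)
Lemma sum_lift_perm d (i : 'I_d.+1) (F : 'S_d.+1 -> V) :
  \sum_s F s = \sum_j \sum_(s : 'S_d) F (lift_perm i j s).
Proof.
rewrite (partition_big (fun s : 'S_d.+1 => s i) xpredT) //=.
apply: eq_bigr => j _; rewrite (reindex (lift_perm i j)) /=.
  by apply: eq_bigl => s; rewrite lift_perm_id eqxx.
(* ulsf s is s seen as a permutation of the points other than i. *)
pose ulsf (s : 'S_d.+1) l := odflt l (unlift (s i) (s (lift i l))).
have ulsfK (s : 'S_d.+1) l : lift (s i) (ulsf s l) = s (lift i l).
  rewrite /ulsf; have:= neq_lift i l.
  by rewrite -(can_eq (permK s)) => /unlift_some[] ? ? ->.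
have inj_ulsf s : injective (ulsf s).
  move=> l1 l2 /(congr1 (lift (s i))); rewrite !ulsfK.
  by move/perm_inj/lift_inj.
exists (fun s => perm (inj_ulsf s)) => [s _ | s].
  by apply/permP=> l; rewrite permE /ulsf lift_perm_lift lift_perm_id liftK.
move/(s _ =P _) => si; apply/permP=> l.
case: (unliftP i l) => [l'|] ->; rewrite ?lift_perm_id //.
by rewrite lift_perm_lift -si permE ulsfK.
Qed.

(** Composition with the transposition pairs the even permutations with the odd
    ones, so the two halves of the sum cancel in any characteristic. *)
Lemma sum_sign_tperm (T : finType) (x y : T) (F : {perm T} -> V) :
  x != y -> (forall s, F (tperm x y * s)%g = F s) ->
  \sum_(s : {perm T}) (-1) ^+ s *: F s = 0.
Proof.
move=> neq_xy Ft; rewrite (bigID (@odd_perm _)) /=.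
apply: canLR (subrK _) _; rewrite add0r -sumrN.
rewrite (reindex_inj (mulgI (tperm x y))).
apply: eq_big => /= s; rewrite odd_permM odd_tperm neq_xy //=.
by rewrite Ft => /negPf->; rewrite expr1 expr0 scaleN1r scale1r.
Qed.

End AlternatingSums.

(** * The Young symmetry relation for normal-ordered minors *)

Section YoungSymmetry.
Variables (k : comNzRingType) (A : algType k) (T : eqType).
Variables (q : T -> T -> k) (g : T -> T -> A).
Hypothesis qV : forall i j, q i j * q j i = 1.

Definition Qfactor (x y : T * T) : k := q y.1 x.1 * q x.2 y.2.

Hypothesis gC : forall x y : T * T,
  g x.1 x.2 * g y.1 y.2 = Qfactor x y ^+ 2 *: (g y.1 y.2 * g x.1 x.2).

Local Notation N := (normal_word Qfactor (fun x => g x.1 x.2)).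

Definition diagonal_word m (K J : 'I_m -> T) : seq (T * T) :=
  [seq (K a, J a) | a <- enum 'I_m].

(** Without normal ordering this is the Leibniz formula for the determinant. *)
Definition normal_minor m (K J : 'I_m -> T) : A :=
  \sum_(s : 'S_m) (-1) ^+ s *: N (diagonal_word K (J \o s)).

Lemma QfactorV x y : Qfactor x y * Qfactor y x = 1.
Proof.
by rewrite /Qfactor mulrACA qV mul1r qV.
Qed.

(** Bringing one letter to the front isolates the part of a word that the
    exchange below modifies. *)
Lemma diagonal_word_split m (K J : 'I_m -> T) (r : 'I_m) :
  perm_eq (diagonal_word K J)
    ((K r, J r) :: [seq (K a, J a) | a <- enum 'I_m & a != r]).
Proof.
rewrite -[(K r, J r) :: _]/[seq (K a, J a) | a <- r :: _]; apply: perm_map.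
by rewrite -rem_filter ?enum_uniq // perm_to_rem // mem_enum.
Qed.

(** The letters at r and r' having the same row, exchanging their columns only
    permutes the letters of the two words taken together. *)
Lemma normal_word_exchange m m' (K J1 J2 : 'I_m -> T) (K' J1' J2' : 'I_m' -> T)
    (r : 'I_m) (r' : 'I_m') :
    K r = K' r' -> J1 r = J2' r' -> J2 r = J1' r' ->
    (forall a, a != r -> J1 a = J2 a) ->
    (forall b, b != r' -> J1' b = J2' b) ->
  N (diagonal_word K J1 ++ diagonal_word K' J1') =
  N (diagonal_word K J2 ++ diagonal_word K' J2').
Proof.
move=> Kr Jr Jr' Ja Jb; apply: (normal_word_perm QfactorV gC).
rewrite (permPl (perm_cat (diagonal_word_split K J1 r)
  (diagonal_word_split K' J1' r'))).
rewrite perm_sym (permPl (perm_cat (diagonal_word_split K J2 r)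
  (diagonal_word_split K' J2' r'))).
have -> : [seq (K a, J2 a) | a <- enum 'I_m & a != r] =
          [seq (K a, J1 a) | a <- enum 'I_m & a != r].
  by apply/eq_in_map => a; rewrite mem_filter => /andP[/Ja->].
have -> : [seq (K' b, J2' b) | b <- enum 'I_m' & b != r'] =
          [seq (K' b, J1' b) | b <- enum 'I_m' & b != r'].
  by apply/eq_in_map => b; rewrite mem_filter => /andP[/Jb->].
rewrite Kr Jr Jr'; apply/seq.permP => P; rewrite !count_cat /=.
by rewrite addnACA (addnC (P _)) addnACA.
Qed.

Definition cons_fun e (i : T) (J : 'I_e -> T) (b : 'I_e.+1) : T :=
  oapp J i (unlift ord0 b).

(** The classical relation for a fixed term t of the second minor. The sum over
    c and s is a sum over the permutations p of the d + 1 entries of I, where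
    p sends the last position to c; it vanishes by exchanging the entries at
    the last position and at the row r that t pairs with i_c. The inequality
    e < d ensures that r is a row of the first minor. *)
Lemma young_exchange d e (le_ed : (e < d)%N) (K : 'I_d -> T) (I : 'I_d.+1 -> T)
    (J : 'I_e -> T) (t : 'S_e.+1) :
  \sum_(c < d.+1) (-1) ^+ c *: \sum_(s : 'S_d) (-1) ^+ s *:
    N (diagonal_word K (I \o lift c \o s) ++
       diagonal_word (K \o widen_ord le_ed) (cons_fun (I c) J \o t)) = 0.
Proof.
pose F (p : 'S_d.+1) := N (diagonal_word K (I \o p \o lift ord_max) ++
  diagonal_word (K \o widen_ord le_ed) (cons_fun (I (p ord_max)) J \o t)).
pose r := (t^-1)%g ord0; have tr : t r = ord0 by rewrite permKV.
have Falt : \sum_(p : 'S_d.+1) (-1) ^+ p *: F p = 0.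
  apply: (@sum_sign_tperm _ _ _ (lift ord_max (widen_ord le_ed r)) ord_max).
    by rewrite eq_sym neq_lift.
  move=> p; apply: (@normal_word_exchange _ _ _ _ _ _ _ _
    (widen_ord le_ed r) r) => //=.
  - by rewrite permM tpermL tr /cons_fun unlift_none.
  - by rewrite permM tpermR tr /cons_fun unlift_none.
  - move=> a ne_ar; rewrite permM tpermD //; last exact: neq_lift.
    by rewrite (inj_eq lift_inj) eq_sym.
  move=> b ne_br; rewrite /cons_fun; case: unliftP => //= tb.
  by rewrite -tr in tb; rewrite (perm_inj tb) eqxx in ne_br.
(* The permutation lifting s with last position sent to c has sign
   (-1) ^+ (d + c + s). *)
transitivity ((-1) ^+ d *: \sum_(p : 'S_d.+1) (-1) ^+ p *: F p); last first.
  by rewrite Falt scaler0.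
rewrite (sum_lift_perm ord_max) scaler_sumr; apply: eq_bigr => c _.
rewrite !scaler_sumr; apply: eq_bigr => s _; rewrite !scalerA; congr (_ *: _).
  rewrite odd_lift_perm 2!signr_addb !signr_odd /= !mulrA.
  by rewrite -expr2 sqrr_sign mul1r.
rewrite /F lift_perm_id; congr (N (_ ++ _)).
by apply: eq_map => a /=; rewrite lift_perm_lift.
Qed.

(** Each of the two words uses all of its rows and all of its columns once, and
    Q is a product of a row factor and a column factor. Hence the scalar is the
    same for all s and t, and the scalars of a product of minors factor out. *)
Lemma prod_Qfactor m m' (K J : 'I_m -> T) (K' J' : 'I_m' -> T)
    (s : 'S_m) (t : 'S_m') :
  \prod_(x <- diagonal_word K (J \o s))
     \prod_(y <- diagonal_word K' (J' \o t)) Qfactor x y =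
  (\prod_a \prod_b q (K' b) (K a)) * (\prod_a \prod_b q (J a) (J' b)).
Proof.
rewrite big_map big_enum [X in _ * X](reindex_inj (@perm_inj _ s)) -big_split.
apply: eq_bigr => a _.
rewrite big_map big_enum /= [X in _ * X](reindex_inj (@perm_inj _ t)).
by rewrite -big_split.
Qed.

(** The prefactors are designed to make the scalar C common to all the terms of
    the sum, which reduces the relation to [young_exchange]. *)
Lemma normal_minor_young d e (le_ed : (e < d)%N) (K : 'I_d -> T)
    (I : 'I_d.+1 -> T) (J : 'I_e -> T) :
  \sum_(c < d.+1)
    ((-1) ^+ c * (\prod_(mu < d) q (I c) (I (lift c mu)))
               * (\prod_(nu < e) q (I c) (J nu)))
    *: (normal_minor K (I \o lift c)
        * normal_minor (K \o widen_ord le_ed) (cons_fun (I c) J)) = 0.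
Proof.
pose C := (\prod_a \prod_b q (K (widen_ord le_ed b)) (K a)) *
          (\prod_c \prod_nu q (I c) (J nu)).
have coefE c : (\prod_(mu < d) q (I c) (I (lift c mu))) *
    (\prod_(nu < e) q (I c) (J nu)) *
    ((\prod_a \prod_b q (K (widen_ord le_ed b)) (K a)) *
     (\prod_a \prod_b q (I (lift c a)) (cons_fun (I c) J b))) = C.
  (* For each i^c_a, the factor at the column i_c is split off from those at J. *)
  under [X in _ * (_ * X)]eq_bigr => a _.
    rewrite big_ord_recl /cons_fun unlift_none /=.
    under eq_bigr => b _ do rewrite liftK /=.
    over.
  rewrite big_split /=.
  have := @big1 _ _ *%R 'I_d (index_enum _) xpredT
    (fun mu => q (I c) (I (lift c mu)) * q (I (lift c mu)) (I c))
    (fun _ _ => qV _ _).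
  rewrite big_split /=.
  set x := \prod_(i < d) q _ _; set y := \prod_(i < d) q _ _ => xy.
  transitivity (x * y * C); last by rewrite xy mul1r.
  by rewrite /C (bigD1_ord c) //=; ring.
clearbody C.
have termE (c : 'I_d.+1) : ((-1) ^+ c * (\prod_(mu < d) q (I c) (I (lift c mu)))
               * (\prod_(nu < e) q (I c) (J nu)))
    *: (normal_minor K (I \o lift c)
        * normal_minor (K \o widen_ord le_ed) (cons_fun (I c) J)) =
  C *: \sum_(t : 'S_e.+1) (-1) ^+ t *: ((-1) ^+ c *: \sum_(s : 'S_d)
    (-1) ^+ s *: N (diagonal_word K (I \o lift c \o s) ++
       diagonal_word (K \o widen_ord le_ed) (cons_fun (I c) J \o t))).
  rewrite mulr_suml !scaler_sumr.
  under eq_bigr => s _ do rewrite mulr_sumr scaler_sumr.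
  rewrite exchange_big /=; apply: eq_bigr => t _.
  rewrite !scaler_sumr; apply: eq_bigr => s _.
  rewrite -scalerAl -scalerAr (normal_wordM _ QfactorV) prod_Qfactor.
  rewrite !scalerA -(coefE c) /=; congr (_ *: _).
  set x := \prod_(mu < d) _; set y := \prod_(nu < e) _.
  set z := (_ * \prod_a \prod_b q (I (lift c a)) _).
  move: ((-1) ^+ c) ((-1) ^+ s) ((-1) ^+ t) x y z => eps_c eps_s eps_t x y z.
  by ring.
under eq_bigr => c _ do rewrite termE.
rewrite -scaler_sumr exchange_big /= big1 ?scaler0 // => t _.
by rewrite -scaler_sumr young_exchange scaler0.
Qed.

End YoungSymmetry.

(** * Minors of the quantum group GL_theta(n) *)

Section MinorsGLtheta.
Variables (R : realType) (n : nat) (theta : 'M[R[i]]_n).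
Hypothesis htheta : theta^T = - theta.

Lemma qthetaV i j : qtheta theta i j * qtheta theta j i = 1.
Proof.
rewrite /qtheta -cexpD -mulrDr.
have -> : theta j i = - theta i j by move/matrixP/(_ i j): htheta; rewrite !mxE.
by rewrite subrr mulr0 cexp0.
Qed.

(** A minor is given by its row and column functions, up to pointwise equality:
    this absorbs the casts and reindexings of the tuples. *)
Lemma minorE m (K J : m.-tuple 'I_n) (K' J' : 'I_m -> 'I_n) :
    tnth K =1 K' -> tnth J =1 J' ->
  minor theta K J = normal_minor (qtheta theta) (gtheta theta) K' J'.
Proof.
move=> eqK eqJ; apply: eq_bigr => s _.
rewrite normal_word_ord scalerA; congr (_ * _ *: _).
  by apply: eq_bigr => a _; apply: eq_bigr => b _; rewrite /= !eqK !eqJ.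
by apply: eq_bigr => a _; rewrite /= eqK eqJ.
Qed.

End MinorsGLtheta.

(* The 0-based index c stands for gamma = c + 1. *)
Theorem proposition5p16 (R : realType) (n : nat) (hn : (1 <= n)%N)
  (theta : 'M[R[i]]_n) (htheta : theta^T = - theta)
  (d d' : nat) (hd' : (1 <= d')%N) (hd'd : (d' <= d)%N) (hdn : (d <= n)%N)
  (I : d.+1.-tuple 'I_n) (J : d'.-1.-tuple 'I_n) :
  \sum_(c < d.+1)
    ((-1) ^+ c.+2
       * (\prod_(mu < d) qtheta theta (tnth I c) (tnth (del_entry I c) mu))
       * (\prod_(nu < d'.-1) qtheta theta (tnth I c) (tnth J nu)))
    *: (minor_cols theta hdn (del_entry I c)
        * minor_cols theta (leq_trans hd'd hdn) (cons_entry hd' (tnth I c) J))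
  = 0.
Proof.
case: d' hd' hd'd J => // e he le_ed J; rewrite /= in J *.
have young := normal_minor_young (qthetaV htheta)
  (fun x y => gtheta_rel theta x.1 x.2 y.1 y.2)
  le_ed (widen_ord hdn) (tnth I) (tnth J).
apply: etrans young; apply: eq_bigr => c _.
have coef_eq : (-1) ^+ c.+2
    * (\prod_(mu < d) qtheta theta (tnth I c) (tnth (del_entry I c) mu)) =
    (-1) ^+ c * \prod_(mu < d) qtheta theta (tnth I c) (tnth I (lift c mu)).
  rewrite !exprS !mulN1r opprK; congr (_ * _).
  by apply: eq_bigr => mu _; rewrite tnth_mktuple.
rewrite coef_eq.
have left_eq : minor_cols theta hdn (del_entry I c) =
    normal_minor (qtheta theta) (gtheta theta) (widen_ord hdn)
      (tnth I \o lift c).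
  by apply: minorE => a; rewrite tnth_mktuple.
have right_eq :
    minor_cols theta (leq_trans le_ed hdn) (cons_entry he (tnth I c) J) =
    normal_minor (qtheta theta) (gtheta theta)
      (widen_ord hdn \o widen_ord le_ed) (cons_fun (tnth I c) (tnth J)).
  apply: minorE => b; first by rewrite tnth_mktuple; apply: val_inj.
  rewrite /cons_entry tcast_id /cons_fun.
  by case: unliftP => [b'|] ->; rewrite ?tnthS ?tnth0.
by rewrite left_eq right_eq.
Qed.
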